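(* Let $(X,d)$ be a nonempty metric space whose distance set $D=d(X\times X)$ is finite, and suppose there exists $r\in D$ such that the threshold relation $R_r^X$ is connected over $X$ and separating over $X$. Suppose that $$(X,d)\cong A_1^{m_1}\times_\infty\cdots\times_\infty A_s^{m_s},$$ where $s\geq 1$, $A_1,\dots,A_s$ are pairwise nonisometric $\ell^\infty$-prime metric spaces, and $m_i\geq 1$ is an integer for every $1\leq i\leq s$. Let $k\geq 2$ be an integer. If some $m_i$ is not divisible by $k$, then $\mathbf{PowStr}_k(X)$ has no objects. If $k\mid m_i$ for every $1\leq i\leq s$, then $$\sqrt[k]{X}=A_1^{m_1/k}\times_\infty\cdots\times_\infty A_s^{m_s/k}$$ is well defined up to isometry (its isometry class does not depend on the chosen finite decomposition $(X,d)\cong A_1^{m_1}\times_\infty\cdots\times_\infty A_s^{m_s}$ of $X$ with $s\geq 1$, pairwise nonisometric $\ell^\infty$-prime metric spaces $A_1,\dots,A_s$, and integers $m_i\geq 1$), and every ordered $\ell^\infty$ $k$-power structure on $X$ arises from a presentation $(P,\phi)$ whose root $P$ is isometric to $\sqrt[k]{X}$. Moreover, in this case, after fixing an isometry $\phi_0:\Delta_k(\sqrt[k]{X})\to X$, the set $$H_{\phi_0,k}=\{\phi_0\circ f^{\times k}\circ\phi_0^{-1}: f\in\operatorname{Iso}(\sqrt[k]{X})\}$$ is a subgroup of $\operatorname{Iso}(X)$, and the coset set $\operatorname{Iso}(X)/H_{\phi_0,k}=\{gH_{\phi_0,k}:g\in\operatorname{Iso}(X)\}$ is in bijection with $\ope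ratorname{Ob}(\mathbf{PowStr}_k(X))$.
   Context: All metric spaces are nonempty and all isometries are bijective; $\cong$ means isometric; $\operatorname{Iso}(X)$ is the group of isometries $X\to X$. Finite products $\times_\infty$ and powers carry the max product metric $d(p,q)=\max_j d_j(p_j,q_j)$; $\Delta_k(P)$ denotes $P^k$ with this metric. For $f:P\to Q$, $f^{\times k}:P^k\to Q^k$ is the coordinatewise map, and $\pi_j:P^k\to P$ is the $j$-th projection. A metric space $X$ is $\ell^\infty$-prime if $|X|>1$ and every isometry $X\cong Y\times_\infty Z$ forces $|Y|=1$ or $|Z|=1$. For $r\geq 0$, $R_r^X(x,y)\iff d(x,y)\leq r$. $R_r^X$ is connected over $X$ if for all distinct $x,y\in X$ there is a finite sequence $x=x_0,\dots,x_n=y$ with $R_r^X(x_i,x_{i+1})$ for all $0\le i<n$. $R_r^X$ is separating over $X$ if for all distinct $x,y\in X$ there is $z\in X$ such that exactly one of $R_r^X(z,x)$, $R_r^X(z,y)$ holds. For an equivalence relation $E$ on $X$, $\bar d_E([x]_E,[y]_E):=\inf\{d(x',y'):x'Ex,\ y'Ey\}$. An ordered ($\ell^\infty$) $k$-power structure on $(X,d)$ is a tuple $(E_1,\dots,E_k,\tau_2,\dots,\tau_k)$ with $E_j$ equivalence relations on $X$ and $\tau_j:X/E_j\to X/E_1$ maps such that: each $\bar d_{E_j}$ is a metric on $X/E_j$; for all classes $C_j\in X/E_j$ ($1\le j\le k$), $\bigcap_{j=1}^kC_j$ is exactly one point; $d(x,y)=\max_{1\le j\le k}\bar d_{E_j}([x]_{E_j},[y]_{E_j})$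 for all $x,y$; each $\tau_j:(X/E_j,\bar d_{E_j})\to (X/E_1,\bar d_{E_1})$ is an isometry. $\mathbf{PowStr}_k(X)$ is the discrete category of these structures. A presentation is a pair $(P,\phi)$ with $P$ a metric space (its root) and $\phi:\Delta_k(P)\to X$ an isometry. The structure arising from $(P,\phi)$ is $(E_1^\phi,\dots,E_k^\phi,\tau_2^\phi,\dots,\tau_k^\phi)$, where $q_j^\phi:=\pi_j\circ\phi^{-1}$, $xE_j^\phi y\iff q_j^\phi(x)=q_j^\phi(y)$, $\bar q_j^\phi:X/E_j^\phi\to P$ is the induced map, and $\tau_j^\phi:=(\bar q_1^\phi)^{-1}\circ\bar q_j^\phi$. *)

(* Defs.v *)
(* Metric spaces are [metricType R] for [R : realType].  A [metricType] may be
   empty, so nonemptiness has to be assumed where it is not implied. *)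
From HB Require Import structures.
From mathcomp Require Import all_boot all_order all_algebra.
From mathcomp Require Import generic_quotient.
From mathcomp Require Import all_classical reals topology.

Set Implicit Arguments.
Unset Strict Implicit.
Unset Printing Implicit Defensive.

Import Order.TTheory GRing.Theory Num.Theory.

Local Open Scope classical_set_scope.
Local Open Scope ring_scope.
Local Open Scope quotient_scope.

(* The library's pseudometric on [U * V] already has the balls of the max
   metric; here it is completed to a metric. *)
Section MaxMetricPair.
Context {R : realType} {U V : metricType R}.
Implicit Types p q : U * V.

Let dist p q : R := Num.max (mdist p.1 q.1) (mdist p.2 q.2).

Let dist_ge0 p q : 0 <= dist p q.
Proof. by rewrite /dist le_max mdist_ge0. Qed.

Let dist_positivity p q : dist p q = 0 -> p = q.
Proof.
case: p q => [u v] [u' v']; rewrite /dist/= => d0; congr (_, _);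
  by apply/mdist_positivity/le_anti; rewrite mdist_ge0 -d0 le_max lexx ?orbT.
Qed.

Let ballEdist p e : ball p e = [set q | dist p q < e].
Proof.
apply/seteqP; split=> q; rewrite /ball/= /prod_ball !ballEmdist/= /dist gt_max.
  by move=> [-> ->].
by move=> /andP[].
Qed.

HB.instance Definition _ :=
  PseudoMetric_isMetric.Build R (U * V)%type dist_ge0 dist_positivity ballEdist.

End MaxMetricPair.

(* An alias of the dependent function space, because the latter carries the
   (different) uniform structures of [function_spaces]. *)
Definition maxprod {R : realType} {I : finType} (T : I -> metricType R) : Type :=
  forall i, T i.

Section MaxMetric.
Context {R : realType} {I : finType} (T : I -> metricType R).
Implicit Types p q : maxprod T.

(* Distances are nonnegative, so the default value 0 only matters when [I] is
   empty. *)
Let dist p q : R := \big[Num.max/0]_(i : I) mdist (p i) (q i).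

Let dist_ge i p q : mdist (p i) (q i) <= dist p q.
Proof. by rewrite /dist; apply: (le_bigmax _ (fun i => mdist (p i) (q i))). Qed.

Let distxx p : dist p p = 0.
Proof. by rewrite /dist; elim/big_ind: _ => // [x y -> ->|i _];
  [exact: maxxx|exact: mdistxx]. Qed.

Let dist_positivity p q : dist p q = 0 -> p = q.
Proof.
move=> d0; apply: functional_extensionality_dep => i.
by apply/mdist_positivity/le_anti; rewrite mdist_ge0 andbT -d0 dist_ge.
Qed.

Let dist_sym p q : dist p q = dist q p.
Proof. by apply: eq_bigr => i _; exact: metric_sym. Qed.

Let dist_triangle q p s : dist p s <= dist p q + dist q s.
Proof.
apply/bigmax_leP; split=> [|i _].
  by rewrite addr_ge0 //; apply: bigmax_ge_id.
by rewrite (le_trans (metric_triangle _ (q i) _)) // lerD.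
Qed.

HB.instance Definition _ := Choice.copy (maxprod T) (forall i, T i).
HB.instance Definition _ := isMetric.Build R (maxprod T)
  distxx dist_positivity dist_sym dist_triangle.

End MaxMetric.

Notation maxpow k P := (maxprod (fun _ : 'I_k => P)).

(* An isometry is stored with its (unique) inverse. *)
Record isom {R : realType} (X Y : metricType R) := Isom {
  isom_fun :> X -> Y;
  isom_inv : Y -> X;
  isomK : cancel isom_fun isom_inv;
  isom_invK : cancel isom_inv isom_fun;
  isom_dist : forall x y, mdist (isom_fun x) (isom_fun y) = mdist x y }.

Notation "X ≅ Y" := ($| isom X Y |) (at level 70, no associativity).

Section Isometries.
Context {R : realType}.
Implicit Types X Y Z P : metricType R.

Lemma isom_eq X Y (f g : isom X Y) : (f : X -> Y) =1 g -> f = g.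
Proof.
case: f g => [f f' fK f'K df] [g g' gK g'K dg] /= /funext fg.
rewrite -fg in gK g'K dg *; have fg' : f' = g'.
  by apply/funext => y; apply: (can_inj fK); rewrite f'K g'K.
by rewrite -fg' in gK g'K *; congr Isom; exact: Prop_irrelevance.
Qed.

Definition isom_id X : isom X X :=
  @Isom R X X id id (fun=> erefl) (fun=> erefl) (fun _ _ => erefl).

Lemma isom_inv_dist X Y (f : isom X Y) x y :
  mdist (isom_inv f x) (isom_inv f y) = mdist x y.
Proof. by rewrite -(isom_dist f) !isom_invK. Qed.

Definition isom_sym X Y (f : isom X Y) : isom Y X :=
  Isom (isom_invK f) (isomK f) (isom_inv_dist f).

Lemma isom_comp_dist X Y Z (g : isom Y Z) (f : isom X Y) x y :
  mdist ((g \o f) x) ((g \o f) y) = mdist x y.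
Proof. by rewrite /= !isom_dist. Qed.

Definition isom_comp X Y Z (g : isom Y Z) (f : isom X Y) : isom X Z :=
  Isom (can_comp (isomK g) (isomK f)) (can_comp (isom_invK f) (isom_invK g))
       (isom_comp_dist g f).

Definition pow_fun k X Y (f : X -> Y) (p : maxpow k X) : maxpow k Y :=
  fun j => f (p j).

Lemma pow_funK k X Y (f : X -> Y) (g : Y -> X) :
  cancel f g -> cancel (@pow_fun k X Y f) (@pow_fun k Y X g).
Proof. by move=> fK p; apply/funext => j; exact: fK. Qed.

Lemma isom_pow_dist k P (f : isom P P) (p q : maxpow k P) :
  mdist (pow_fun f p) (pow_fun f q) = mdist p q.
Proof. by apply: eq_bigr => j _; exact: isom_dist. Qed.

Definition isom_pow k P (f : isom P P) : isom (maxpow k P) (maxpow k P) :=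
  Isom (pow_funK (isomK f)) (pow_funK (isom_invK f)) (@isom_pow_dist k P f).

End Isometries.

Section IsoGroup.
Context {R : realType} (X : metricType R).

HB.instance Definition _ := gen_eqMixin (isom X X).
HB.instance Definition _ := gen_choiceMixin (isom X X).

Let isom_mulA : associative (@isom_comp R X X X).
Proof. by move=> f g h; exact: isom_eq. Qed.
Let isom_mul1 : left_id (isom_id X) (@isom_comp R X X X).
Proof. by move=> f; exact: isom_eq. Qed.
Let isom_mulr1 : right_id (isom_id X) (@isom_comp R X X X).
Proof. by move=> f; exact: isom_eq. Qed.
Let isom_mulV : left_inverse (isom_id X) (@isom_sym R X X) (@isom_comp R X X X).
Proof. by move=> f; apply: isom_eq => x /=; rewrite isomK. Qed.
Let isom_mulrV :
  right_inverse (isom_id X) (@isom_sym R X X) (@isom_comp R X X X).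
Proof. by move=> f; apply: isom_eq => x /=; rewrite isom_invK. Qed.

HB.instance Definition _ := isGroup.Build (isom X X)
  isom_mulA isom_mul1 isom_mulr1 isom_mulV isom_mulrV.

End IsoGroup.

Notation Iso X := (isom X X).

Definition left_coset {G : groupType} (H : set G) (g : G) : set G :=
  [set (g * h)%g | h in H].

Definition left_cosets {G : groupType} (H : set G) : set (set G) :=
  range (left_coset H).

Section Relations.
Context {T : Type} (S : rel T).

Definition connected_over : Prop := forall x y, x <> y ->
  exists2 s : seq T, path S x s & last x s = y.

Definition separating_over : Prop := forall x y, x <> y ->
  exists z, S z x (+) S z y.

End Relations.

Section MetricNotions.
Context {R : realType}.

Definition distance_set (X : metricType R) : set R :=
  [set mdist z.1 z.2 | z in [set: X * X]].

Definition threshold (X : metricType R) (r : R) : rel X :=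
  fun x y => mdist x y <= r.

Definition linf_prime (X : metricType R) : Prop :=
  (exists x y : X, x <> y) /\
  forall Y Z : metricType R, isom X (Y * Z)%type ->
    (exists y0 : Y, all_equal_to y0) \/ (exists z0 : Z, all_equal_to z0).

Definition power_prod s (A : 'I_s -> metricType R) (m : 'I_s -> nat) :
  metricType R := maxprod (fun i => maxpow (m i) (A i)).

Definition prime_decomposition (X : metricType R)
    s (A : 'I_s -> metricType R) (m : 'I_s -> nat) : Prop :=
  [/\ (1 <= s)%N,
      forall i, linf_prime (A i),
      forall i j, i != j -> ~ (A i ≅ A j),
      forall i, (1 <= m i)%N &
      X ≅ power_prod A m].

Definition kth_root k s (A : 'I_s -> metricType R) (m : 'I_s -> nat) :
  metricType R := power_prod A (fun i => m i %/ k)%N.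

Record is_metric {T : Type} (d : T -> T -> R) : Prop := {
  is_metric_xx : forall x, d x x = 0;
  is_metric_eq : forall x y, d x y = 0 -> x = y;
  is_metric_sym : forall x y, d x y = d y x;
  is_metric_triangle : forall y x z, d x z <= d x y + d y z }.

Definition quot_dist (X : metricType R) (E : equiv_rel X)
    (C D : {eq_quot E}) : R :=
  inf [set mdist z.1 z.2 | z in
        [set z : X * X | \pi_{eq_quot E} z.1 = C /\ \pi_{eq_quot E} z.2 = D]].

End MetricNotions.

(* Indices 1, ..., k are shifted to 0, ..., k-1, so that the maps tau_2, ...,
   tau_k are indexed by the nonzero elements of ['I_k]. *)
Section PowerStructures.
Context {R : realType} (X : metricType R) (k : nat) (k_ge2 : (2 <= k)%N).

Definition fst_ord : 'I_k := Ordinal (ltnW k_ge2).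

Record power_data := PowerData {
  pow_rel : 'I_k -> equiv_rel X;
  pow_tau : forall j : 'I_k, (0 < j)%N ->
    {eq_quot pow_rel j} -> {eq_quot pow_rel fst_ord} }.

Arguments pow_tau S {j} j0 C : rename.

Record is_power_structure (S : power_data) : Prop := {
  pow_metric : forall j, is_metric (@quot_dist R X (pow_rel S j));
  pow_transversal : forall C : (forall j, {eq_quot pow_rel S j}),
    exists! x : X, forall j, \pi_{eq_quot pow_rel S j} x = C j;
  pow_dist : forall x y : X, mdist x y =
    \big[Num.max/0]_(j < k) quot_dist (\pi_{eq_quot pow_rel S j} x)
                                      (\pi_{eq_quot pow_rel S j} y);
  pow_tau_bij : forall (j : 'I_k) (j0 : (0 < j)%N), bijective (pow_tau S j0);
  pow_tau_dist : forall (j : 'I_k) (j0 : (0 < j)%N) C D,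
    quot_dist (pow_tau S j0 C) (pow_tau S j0 D) = quot_dist C D }.

Record power_structure := PowerStructure {
  pow_data :> power_data;
  pow_structureP : is_power_structure pow_data }.

Section Arising.
Context (P : metricType R) (phi : isom (maxpow k P) X).

Definition pres_coord (j : 'I_k) (x : X) : P := isom_inv phi x j.

Lemma pres_rel_refl j : reflexive (fun x y => pres_coord j x == pres_coord j y).
Proof. by move=> x /=. Qed.
Lemma pres_rel_sym j : symmetric (fun x y => pres_coord j x == pres_coord j y).
Proof. by move=> x y /=; rewrite eq_sym. Qed.
Lemma pres_rel_trans j : transitive (fun x y => pres_coord j x == pres_coord j y).
Proof. by move=> y x z /= /eqP -> . Qed.

Definition pres_rel (j : 'I_k) : equiv_rel X :=
  EquivRel (fun x y => pres_coord j x == pres_coord j y)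
    (@pres_rel_refl j) (@pres_rel_sym j) (@pres_rel_trans j).

Definition pres_bar (j : 'I_k) (C : {eq_quot pres_rel j}) : P :=
  pres_coord j (repr C).

(* The inverse of [pres_bar j]: any point with j-th coordinate [p] would do. *)
Definition pres_bar_inv (j : 'I_k) (p : P) : {eq_quot pres_rel j} :=
  \pi_{eq_quot pres_rel j} (phi (fun=> p)).

Lemma pres_bar_pi j x : pres_bar (\pi_{eq_quot pres_rel j} x) = pres_coord j x.
Proof.
apply/eqP; rewrite -[_ == _]/(pres_rel j _ _).
by rewrite -(@pi_eq_quot _ _ {eq_quot pres_rel j}) reprK.
Qed.

Lemma pres_barK j : cancel (@pres_bar j) (pres_bar_inv j).
Proof.
move=> C; rewrite -{2}[C]reprK; apply/eqP.
by rewrite /pres_bar_inv pi_eq_quot /= /pres_coord isomK.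
Qed.

Lemma pres_bar_invK j : cancel (pres_bar_inv j) (@pres_bar j).
Proof. by move=> p; rewrite /pres_bar_inv pres_bar_pi /pres_coord isomK. Qed.

Definition arising_data : power_data :=
  @PowerData pres_rel (fun j _ => pres_bar_inv fst_ord \o @pres_bar j).

End Arising.

Definition diagonal_isos (P : metricType R) (phi0 : isom (maxpow k P) X) :
    set (Iso X) :=
  [set isom_comp (isom_comp phi0 (isom_pow k f)) (isom_sym phi0) | f in [set: Iso P]].

End PowerStructures.

(* Main.v *)
From HB Require Import structures.
Require Import Defs.
From mathcomp Require Import all_boot all_order all_algebra.
From mathcomp Require Import generic_quotient.
From mathcomp Require Import all_classical reals topology.

(** The theorem rests on unique factorization for max products, and that on
    a commutation property of product decompositions of graphs.

    Graphs.  Write N(x) for the set of points within distance [r] of [x].  In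
    a max product every such set is a rectangle, so a decomposition of X as a
    metric space is also a decomposition of the reflexive graph given by the
    threshold relation.  A decomposition X = X1 x X2 is recorded by the single
    operation f(x, y) = (x1, y2) (see [decomp_op]).  Theorem [decomp_comm]
    says that on a connected separating graph any two of these operations
    commute; this is the strict refinement property, established for graphs
    by McKenzie.  The order by inclusion of the sets N(x) is antisymmetric
    because the graph is separating, and it is coordinatewise for both
    decompositions.  Comparing rectangles of the form N(x) :&: N(y) in the two
    coordinate systems gives inequalities in this order, and playing them
    against each other gives commutation on small squares ([mix_same2],
    [square_eq]).  Paths then carry it to the whole graph.

    Factorization.  Let X be a product of prime spaces A_i and also a product
    of arbitrary spaces B_j, and fix a base point o.  By commutation the copy
    of A_i through o is closed under the decomposition operations of the
    B_j, so primality forces each of them to be trivial there: the copy of A_i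
    lies in the copy of some B_j ([prime_in_factor]).  Hence B_j is
    the product of the A_i that lie in it ([factor_iso]), and two prime
    factorizations agree up to a bijection of isometric factors
    ([factor_matching]).  If X is isometric to P^k, one copy of P is a product
    of some of the A_i, with A_i occurring n_i times, so X is the product
    of the A_i^(k n_i); comparing exponents gives m_i = k n_i, that is,
    divisibility and the root at once ([power_root]).

    Structures.  A power structure is the same thing as a presentation up to
    renaming of the root: its quotient X/E_1 is a root, and the map
    x |-> (tau_j [x]_j)_j is the inverse of the presentation
    ([power_structure_arises]).  Two presentations induce the same structure
    exactly when an isometry between the roots turns the coordinates of one
    into those of the other ([arising_root_isom]).  For a fixed [phi0] this says that
    [g |-> structure of g \o phi0] is onto and that its fibres are the left
    cosets of the diagonal isometries. *)

Set Implicit Arguments.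
Unset Strict Implicit.
Unset Printing Implicit Defensive.

Import Order.TTheory GRing.Theory Num.Theory.

Local Open Scope classical_set_scope.
Local Open Scope card_scope.
Local Open Scope ring_scope.

(** * Commuting decompositions of a graph *)

Definition swap {T U : Type} (f : T -> T -> U) : T -> T -> U :=
  fun x y => f y x.

(** The operation (x, y) |-> (x1, y2) of a decomposition X = X1 x X2 under which
    [R] is the product of a relation on X1 and a relation on X2.  The two
    factors are recovered as quotients of the carrier, so that several
    decompositions of one set can be compared without naming factor types, and
    exchanging the two factors amounts to [swap]. *)
Record decomp_op {T : Type} (R : rel T) (f : T -> T -> T) : Prop := {
  dec_id : forall x, f x x = x;
  dec_l : forall x y z, f (f x y) z = f x z;
  dec_r : forall x y z, f x (f y z) = f x z;
  dec_rel : forall x x' y y', R x x' -> R y y' -> R (f x y) (f x' y') }.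

Lemma decomp_swap {T : Type} (R : rel T) f :
  decomp_op R f -> decomp_op R (swap f).
Proof.
case=> fid fl fr fR; split; rewrite /swap => //.
by move=> x x' y y' Rx Ry; exact: fR.
Qed.

(** [f x y] keeps the first coordinate of [x], so it equals [x] exactly when the
    second coordinates agree.  The points related to [x] form the f-slice
    of [x]. *)
Definition same2 {T : Type} (f : T -> T -> T) (x y : T) : Prop := f x y = x.
Definition same1 {T : Type} (f : T -> T -> T) (x y : T) : Prop :=
  same2 (swap f) x y.

Section Same.
Context {T : Type} {R : rel T} {f : T -> T -> T} (Df : decomp_op R f).

Lemma same2_sym x y : same2 f x y -> same2 f y x.
Proof. by rewrite /same2 => xy; rewrite -{1}xy (dec_r Df) (dec_id Df). Qed.

Lemma same2_trans x y z : same2 f x y -> same2 f y z -> same2 f x z.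
Proof. by rewrite /same2 => xy yz; rewrite -[LHS](dec_r Df _ y) yz. Qed.

Lemma same1E x y : same1 f x y -> f x y = y.
Proof.
by rewrite /same1 /same2 /swap => xy; rewrite -{1}xy (dec_l Df) (dec_id Df).
Qed.

End Same.

Section Thin.
Context {T : Type} (R : rel T).

(** Inclusion of neighbourhoods.  In a separating graph it is antisymmetric, and
    it will be compared with the coordinates of several decompositions. *)
Definition below x y := forall z, R z x -> R z y.

Lemma below_trans y x z : below x y -> below y z -> below x z.
Proof. by move=> xy yz u /xy/yz. Qed.

Lemma below_refl x : below x x. Proof. by []. Qed.

Context (Rxx : reflexive R)
  (thin : forall x y, below x y -> below y x -> x = y).

(** A neighbourhood is a product of neighbourhoods in the factors, and
    reflexivity makes both of these nonempty; so inclusion of neighbourhoods is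
    the product of the inclusions in the two factors. *)
Lemma below_dec f x x' y y' : decomp_op R f -> below x x' -> below y y' ->
  below (f x y) (f x' y').
Proof.
move=> Df xx' yy' z Rz.
have /xx' Rx : R (f z x) x.
  by move: (dec_rel Df Rz (Rxx x)); rewrite (dec_l Df) (dec_id Df).
have /yy' Ry : R (f y z) y.
  by move: (dec_rel Df (Rxx y) Rz); rewrite (dec_r Df) (dec_id Df).
by move: (dec_rel Df Rx Ry); rewrite (dec_l Df) (dec_r Df) (dec_id Df).
Qed.

(** In the second factor the coordinate of [t] is squeezed between the equal
    coordinates of [x] and [y]. *)
Lemma same2_between f x t y : decomp_op R f ->
  below x (f x t) -> below t y -> same2 f x y -> same2 f x t.
Proof.
move=> Df xt ty xy; apply: thin => //.
by rewrite -{2}xy; apply: (below_dec Df).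
Qed.

Lemma below_same2 f x t : decomp_op R f -> below x t -> below x (f x t).
Proof. by move=> Df xt; rewrite -{1}(dec_id Df x); apply: (below_dec Df). Qed.

Section Two.
Context (f g : T -> T -> T) (Df : decomp_op R f) (Dg : decomp_op R g).

(** Write f-coordinates as (a, b) and g-coordinates as [c, d].  For x = (a, b)
    and y = (a', b) with a common neighbour, N(x) :&: N(y) is a rectangle with
    second f-side N(b), and it is contained in N(g x y) because N(g x y) is a
    g-rectangle.  So b is below the second f-coordinate of [g x y]. *)
Lemma below_mix x y n : same2 f x y -> R n x -> R n y -> below x (f x (g x y)).
Proof.
move=> xy Rnx Rny u Rux; pose v := f n u.
have Rvx : R v x by move: (dec_rel Df Rnx Rux); rewrite (dec_id Df).
have Rvy : R v y by move: (dec_rel Df Rny Rux); rewrite (same2_sym Df xy).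
move: (dec_rel Df Rux (dec_rel Dg Rvx Rvy)).
by rewrite (dec_id Dg) (dec_r Df) (dec_id Df).
Qed.

(** The points form a g-square y0 = [c', d0], y = [c', d'], z0 = [c, d0],
    z = [c, d'] with d0 below d'.  Three corners have second f-coordinate b,
    while z = (a, e) sits above z0 = (a, b); the claim is that e = b.  The
    points V and Y lift y0 and y to the second f-coordinate e.  Squeezing in the
    order shows that Y has second g-coordinate d', and then that V has second
    g-coordinate d0.  So the corner [g z V] is z0, and [below_mix] for z and V
    bounds e by b. *)
Lemma square_flat y0 y z0 n :
  same2 f y0 y -> same2 f y0 z0 -> same1 g y0 y -> same2 g y0 z0 ->
  below y0 y -> below z0 (g z0 y) -> same1 f z0 (g z0 y) ->
  R n y0 -> R n y -> R n z0 -> g z0 y = z0.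
Proof.
move=> y0y y0z0 gy0y gy0z0 ley0 lez0 z0z Rny0 Rny Rnz0.
set z := g z0 y in lez0 z0z *.
have Rnz : R n z by rewrite -(dec_id Dg n); apply: (dec_rel Dg).
pose V := f y0 z; pose Y := f y z.
have yY : below y Y.
  rewrite -{1}(same2_trans Df (same2_sym Df y0y) y0z0); exact: (below_dec Df).
have y0V : below y0 V by rewrite -{1}y0z0; apply: (below_dec Df).
have VY : below V Y by apply: (below_dec Df).
have gYz : g Y z = g Y y by rewrite /z (dec_r Dg).
have YE : g Y y = Y.
  have tY : below (g Y y) Y.
    by rewrite -[X in below _ X](dec_id Dg); apply: (below_dec Dg).
  have yt : below y (g Y y) by rewrite -{1}(dec_id Dg y); apply: (below_dec Dg).
  have s1 : same1 f y (g Y y).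
    apply: (same2_between (decomp_swap Df)) tY _; last first.
      by rewrite /same2 /swap /Y (dec_l Df) (dec_id Df).
    exact: (below_same2 (decomp_swap Df) yt).
  apply: thin => //.
  have YzE : same2 f Y z by rewrite /same2 /Y (dec_l Df).
  have RnY : R n Y by rewrite -(dec_id Df n); apply: (dec_rel Df).
  move: (below_mix YzE RnY Rnz); rewrite gYz.
  by rewrite {2}/Y (dec_l Df) (same1E Df s1).
have sE : g y0 V = y0.
  have sV : below (g y0 V) V.
    by rewrite -[X in below _ X](dec_id Dg); apply: (below_dec Dg).
  have sy : below (g y0 V) y.
    have yE : g y0 (g Y y) = y by rewrite (dec_r Dg); apply: (same1E Dg).
    by rewrite -[X in below _ X]yE YE; apply: (below_dec Dg).
  apply: thin.
    have {2}<- : f V y = y0 by rewrite /V (dec_l Df).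
    by rewrite -[X in below X _](dec_id Df); apply: (below_dec Df).
  by rewrite -{1}(dec_id Dg y0); apply: (below_dec Dg).
apply: thin => //.
have zV : same2 f z V by rewrite /same2 /V (dec_r Df) (dec_id Df).
have RnV : R n V by rewrite -(dec_id Df n); apply: (dec_rel Df).
move: (below_mix zV Rnz RnV).
have -> : g z V = z0.
  by rewrite {1}/z (dec_l Dg) -(dec_r Dg z0 y0) sE (same2_sym Dg gy0z0).
by have -> : f z z0 = z0 by exact: z0z.
Qed.

End Two.

(** With z = g x y and w = g y x, let z0 and w0 be their projections to the
    f-slice of x.  Mixing z0 and w0 by g gives points of the same slice, since
    they lie below x and y and [below_mix] bounds them from below.
    So [square_flat] applies to the square spanned by z0 and w0, with the second
    g-coordinate of z0 raised to that of z. *)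
Lemma mix_half f g (Df : decomp_op R f) (Dg : decomp_op R g) x y n :
  same2 f x y -> R n x -> R n y ->
  g (f (g x y) x) y = f (g x y) x.
Proof.
move=> xy Rnx Rny.
pose z := g x y; pose w := g y x; pose z0 := f z x; pose w0 := f w x.
rewrite -/z -/z0.
have xz : below x (f x z) by exact: (below_mix Df Dg xy Rnx Rny).
have xw : below x (f x w) by exact: (below_mix Df (decomp_swap Dg) xy Rnx Rny).
have z0z : below z0 z.
  rewrite -[X in below _ X](dec_id Df) -[X in below _ X](dec_r Df z x z).
  exact: (below_dec Df).
have w0w : below w0 w.
  rewrite -[X in below _ X](dec_id Df) -[X in below _ X](dec_r Df w x w).
  exact: (below_dec Df).
have Rnn h a b : decomp_op R h -> R n a -> R n b -> R n (h a b).
  by move=> Dh Ra Rb; rewrite -(dec_id Dh n); apply: (dec_rel Dh).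
have Rnz : R n z by exact: Rnn.
have Rnw : R n w by exact: Rnn.
have Rnz0 : R n z0 by exact: Rnn.
have Rnw0 : R n w0 by exact: Rnn.
pose y0 := g w0 z0; pose y1 := g w0 y.
have xz0 : same2 f x z0 by rewrite /same2 (dec_r Df) (dec_id Df).
have z0w0 : same2 f z0 w0 by rewrite /same2 /z0 /w0 (dec_l Df) (dec_r Df).
have y0y1 : below y0 y1.
  by rewrite /y1 -(dec_r Dg w0 x); apply: (below_dec Dg).
have y1y : below y1 y.
  rewrite -[X in below _ X](dec_id Dg) -[X in below _ X](dec_l Dg y x).
  exact: (below_dec Dg).
have xy0' : below x (f x y0).
  have := below_mix Df (decomp_swap Dg) z0w0 Rnz0 Rnw0.
  move=> /(below_dec Df (@below_refl x)).
  by rewrite xz0 (dec_r Df).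
have xy0 : same2 f x y0.
  exact: (same2_between Df xy0' (below_trans y0y1 y1y)).
have xy1 : same2 f x y1.
  apply: (same2_between Df _ y1y xy).
  exact: (below_trans xy0' (below_dec Df _ _)).
have -> : g z0 y = g z0 y1 by rewrite /y1 (dec_r Dg).
have z0t : below z0 (g z0 y).
  rewrite -(dec_r Dg z0 x) -[X in below X _](dec_id Dg); exact: (below_dec Dg).
apply: (square_flat Df Dg (n := n) (y0 := y0)) => //.
- exact: (same2_trans Df (same2_sym Df xy0) xy1).
- exact: (same2_trans Df (same2_sym Df xy0) xz0).
- by rewrite /same1 /same2 /swap /y1 /y0 (dec_l Dg) (dec_r Dg).
- by rewrite /same2 /y0 (dec_l Dg).
- by rewrite /y1 (dec_r Dg).
- rewrite /y1 (dec_r Dg).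
  apply: (same2_between (decomp_swap Df) (y := z)).
  + exact: (below_same2 (decomp_swap Df) z0t).
  + rewrite /z -(dec_l Dg x y y); exact: (below_dec Dg).
  + by rewrite /same2 /swap /z0 (dec_r Df).
- exact: Rnn.
- exact: Rnn.
Qed.

(** Slices of one decomposition are closed under the other, as long as the
    points have a common neighbour.  The two instances of [mix_half], for g
    and for its swap, show that the projection of [g x y] to the f-slice of x
    has the same two g-coordinates as [g x y]. *)
Lemma mix_same2 f g (Df : decomp_op R f) (Dg : decomp_op R g) x y n :
  same2 f x y -> R n x -> R n y -> same2 f x (g x y).
Proof.
move=> xy Rnx Rny.
(* d0 identifies the second g-coordinates of z0 and z, c0 the first ones. *)
have d0 := mix_half Df Dg xy Rnx Rny.
have := mix_half Df (decomp_swap Dg) (same2_sym Df xy) Rny Rnx.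
rewrite /swap -(dec_r Df _ y x) in d0 *; rewrite (same2_sym Df xy) in d0.
move: d0; set z0 := f _ y => d0 c0.
have -> : g x y = z0 by rewrite -[RHS]c0 -[in RHS]d0 (dec_r Dg).
by rewrite /same2 /z0 (dec_r Df).
Qed.

(** A neighbour m of x' is first made a neighbour m1 of both x and x' by giving
    it the first g-coordinate of n.  As x and u have the same first
    f-coordinate, the f-coordinate of m1 can be tested on [N u :&: N x'], which
    is contained in N(q). *)
Lemma square_below_side f g (Df : decomp_op R f) (Dg : decomp_op R g)
    x u x' n :
  same1 f x u -> same2 f x x' -> same2 g x x' ->
  R n x -> R n u -> R n x' -> below x' (f (g x' u) x').
Proof.
move=> fxu fxx' gxx' Rnx Rnu Rnx'; set q := g x' u; set v := f q x'.
have Rnq : R n q by rewrite -(dec_id Dg n); apply: (dec_rel Dg).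
have x'q : same1 g x' q by rewrite /same1 /same2 /swap (dec_l Dg) (dec_id Dg).
have x'v : g x' v = v.
  apply: (same1E Dg).
  exact: (mix_same2 (decomp_swap Dg) (decomp_swap Df) x'q Rnx' Rnq).
move=> m Rmx'; pose m1 := g n m.
have Rm1x : R m1 x by rewrite -gxx'; apply: (dec_rel Dg).
have Rm1x' : R m1 x' by rewrite -(dec_id Dg x'); apply: (dec_rel Dg).
pose m2 := f m1 n.
have Rm2u : R m2 u by rewrite -(same1E Df fxu); apply: (dec_rel Df).
have Rm2x' : R m2 x' by rewrite -(dec_id Df x'); apply: (dec_rel Df).
have Rm2q : R m2 q by rewrite -(dec_id Dg m2); apply: (dec_rel Dg).
have Rm1v : R m1 v.
  by move: (dec_rel Df Rm2q Rm1x'); rewrite (dec_l Df) (dec_id Df).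
by move: (dec_rel Dg Rmx' Rm1v); rewrite (dec_r Dg) (dec_id Dg) x'v.
Qed.

Lemma square_below f g (Df : decomp_op R f) (Dg : decomp_op R g) x u x' n :
  same1 f x u -> same1 g x u -> same2 f x x' -> same2 g x x' ->
  R n x -> R n u -> R n x' -> below (f x' u) (g x' u).
Proof.
move=> fxu gxu fxx' gxx' Rnx Rnu Rnx'; set q := g x' u.
have l1 : below x' (f q x').
  exact: (square_below_side Df Dg fxu fxx' gxx' Rnx Rnu Rnx').
have l2 : below u (f u q).
  exact: (square_below_side (decomp_swap Df) (decomp_swap Dg)
    fxx' fxu gxu Rnx Rnx' Rnu).
have := below_dec Df l1 l2.
by rewrite (dec_l Df) (dec_r Df) (dec_id Df).
Qed.

(** A step from x to u that keeps both first coordinates and a step from x to x'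
    that keeps both second coordinates span a square in either coordinate
    system.  The f-corner is below the g-corner by [square_below], and the
    hypotheses are symmetric in f and g. *)
Lemma square_eq f g (Df : decomp_op R f) (Dg : decomp_op R g) x u x' n :
  same1 f x u -> same1 g x u -> same2 f x x' -> same2 g x x' ->
  R n x -> R n u -> R n x' -> f x' u = g x' u.
Proof.
move=> fxu gxu fxx' gxx' Rnx Rnu Rnx'; apply: thin.
  exact: (square_below Df Dg fxu gxu fxx' gxx' Rnx Rnu Rnx').
exact: (square_below Dg Df gxu fxu gxx' fxx' Rnx Rnu Rnx').
Qed.

(** The edge from x to u is broken at v = f x u: the first half keeps the first
    f-coordinate and is handled by [square_eq], the second half keeps the
    second f-coordinate and is handled by [mix_same2]. *)
Lemma shift_local f g (Df : decomp_op R f) (Dg : decomp_op R g) x x' u :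
  same2 f x x' -> same2 g x x' -> R x x' -> same1 g x u -> R x u ->
  same2 f u (g x' u).
Proof.
move=> fxx' gxx' Rxx' gxu Rxu; pose v := f x u.
have gxv : same1 g x v := mix_same2 (decomp_swap Dg) Df gxu (Rxx x) Rxu.
have fxv : same1 f x v by rewrite /same1 /same2 /swap (dec_l Df) (dec_id Df).
have Rxv : R x v by rewrite -{1}(dec_id Df x); apply: (dec_rel Df).
have v'E := square_eq Df Dg fxv gxv fxx' gxx' (Rxx x) Rxv Rxx'.
have Rxv' : R x (f x' v) by rewrite -{1}(dec_id Df x); apply: (dec_rel Df).
have v'u : same2 f (f x' v) u by rewrite /same2 /v (dec_r Df) (dec_l Df).
have := mix_same2 Df Dg v'u Rxv' Rxu.
rewrite {2}v'E (dec_l Dg).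
by apply: (same2_trans Df) => //; apply: (same2_sym Df).
Qed.

Section Global.
Context (conn : forall x y, exists2 s, path R x s & last x s = y).

(** Only the first g-coordinate of x' enters, and by [mix_same2] the second one
    may be replaced by that of x; so x' may be taken in the g-slice of x.  The
    edge is then carried along a path from x to y by [shift_local]. *)
Lemma shift_edge f g (Df : decomp_op R f) (Dg : decomp_op R g) x x' y :
  same2 f x x' -> R x x' -> same2 f (g x y) (g x' y).
Proof.
move=> fxx' Rxx'; pose z := g x' x.
have fxz : same2 f x z := mix_same2 Df (decomp_swap Dg) fxx' (Rxx x) Rxx'.
have gxz : same2 g x z by rewrite /same2 /z (dec_r Dg) (dec_id Dg).
have Rxz : R x z by rewrite -{1}(dec_id Dg x); apply: (dec_rel Dg).
have -> : g x' y = g z y by rewrite /z (dec_l Dg).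
have [s Rs <-] := conn x y.
suff shift_path y0 : path R y0 s -> same2 f (g x y0) (g z y0) ->
    same2 f (g x (last y0 s)) (g z (last y0 s)).
  apply: shift_path => //; rewrite (dec_id Dg).
  by rewrite (_ : g z x = z) // /z (dec_l Dg).
elim: s y0 {Rs} => //= y1 s IH y0 /andP[Ry /IH{}IH] fy0; apply: IH.
have -> : g z y1 = g (g z y0) (g x y1) by rewrite (dec_l Dg) (dec_r Dg).
apply: (shift_local Df Dg fy0).
- by rewrite /same2 (dec_l Dg) (dec_r Dg).
- exact: (dec_rel Dg).
- by rewrite /same1 /same2 /swap (dec_l Dg) (dec_r Dg).
- exact: (dec_rel Dg).
Qed.

(** A path from x to x' projects to a path inside the f-slice of x, and
    [shift_edge] applies to each of its edges. *)
Lemma shift_same2 f g (Df : decomp_op R f) (Dg : decomp_op R g) x x' y :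
  same2 f x x' -> same2 f (g x y) (g x' y).
Proof.
move=> fxx'; have [s Rs lastE] := conn x x'.
suff shift_path x0 : path R x0 s ->
    same2 f (g (f x0 x) y) (g (f (last x0 s) x) y).
  by have := shift_path _ Rs; rewrite lastE (dec_id Df) (same2_sym Df fxx').
elim: s x0 {Rs lastE} => [|x1 s IH] x0 /=.
  by move=> _; exact: (dec_id Df).
case/andP=> Rx /IH; apply: (same2_trans Df) => //.
apply: shift_edge => //; first by rewrite /same2 (dec_l Df) (dec_r Df).
exact: (dec_rel Df).
Qed.

Lemma shift_same2r f g (Df : decomp_op R f) (Dg : decomp_op R g) x y y' :
  same2 f y y' -> same2 f (g x y) (g x y').
Proof. by move=> yy'; exact: (shift_same2 Df (decomp_swap Dg) x yy'). Qed.

(** Both sides have the same f-coordinates, because equality of either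
    f-coordinate is a congruence for g. *)
Theorem decomp_comm f g (Df : decomp_op R f) (Dg : decomp_op R g) x y z w :
  f (g x y) (g z w) = g (f x z) (f y w).
Proof.
set l := RHS.
have s2 : same2 f l (g z w).
  apply: (same2_trans Df (y := g z (f y w))).
    by apply: shift_same2 => //; rewrite /same2 (dec_l Df).
  by apply: shift_same2r => //; rewrite /same2 (dec_l Df).
have s1 : same1 f l (g x y).
  apply: (same2_trans (decomp_swap Df) (y := g x (f y w))).
    apply: (shift_same2 (decomp_swap Df)) => //.
    by rewrite /same2 /swap (dec_r Df).
  apply: (shift_same2r (decomp_swap Df)) => //.
  by rewrite /same2 /swap (dec_r Df).
have {}s1 : f (g x y) l = l := s1.
by rewrite -[f (g x y) _](dec_l Df _ l) s1 s2.
Qed.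

End Global.
End Thin.

(** * Isometries of max products *)

(** Points of a product of metric spaces are dependent functions, whence a
    dependent form of choice. *)
Lemma dep_choice (I : Type) (T : I -> Type) (P : forall i, T i -> Prop) :
  (forall i, exists a, P i a) -> exists f : forall i, T i, forall i, P i (f i).
Proof. by move=> ex; exists (fun i => sval (cid (ex i))) => i; case: cid. Qed.

Section MetricOf.
Context {R : realType} {T : choiceType} {d : T -> T -> R}.

(** An alias of [T], as [T] may carry another metric. *)
Definition metric_of (dM : is_metric d) : Type := T.

Context (dM : is_metric d).

HB.instance Definition _ := Choice.copy (metric_of dM) T.
HB.instance Definition _ := isMetric.Build R (metric_of dM)
  (is_metric_xx dM) (is_metric_eq dM) (is_metric_sym dM)
  (fun y x z => is_metric_triangle dM y x z).

End MetricOf.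

Section Isometries.
Context {R : realType}.
Implicit Types X Y Z P : metricType R.

Lemma iso_sym X Y : X ≅ Y -> Y ≅ X.
Proof. by case=> f; squash (isom_sym f). Qed.

Lemma iso_trans Y X Z : X ≅ Y -> Y ≅ Z -> X ≅ Z.
Proof. by case=> f [g]; squash (isom_comp g f). Qed.

(** Maps that preserve distances are injective, so no inverse has to be
    exhibited; this is how most isometries below are built. *)
Lemma surj_isom X Y (f : X -> Y) :
    (forall x y, mdist (f x) (f y) = mdist x y) ->
    (forall y, exists x, f x = y) ->
  exists h : isom X Y, (h : X -> Y) = f.
Proof.
move=> fd /choice[g fK].
have gK : cancel f g.
  by move=> x; apply: mdist_positivity; rewrite -fd fK mdistxx.
by exists (Isom gK fK fd).
Qed.

Lemma surj_iso X Y (f : X -> Y) :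
    (forall x y, mdist (f x) (f y) = mdist x y) ->
    (forall y, exists x, f x = y) ->
  X ≅ Y.
Proof. by move=> fd fs; have [h _] := surj_isom fd fs; squash h. Qed.

Section Maxprod.
Context {I : finType} {T : I -> metricType R}.
Implicit Types p q : maxprod T.

Lemma maxprodE p q : mdist p q = \big[Num.max/0]_i mdist (p i) (q i).
Proof. by []. Qed.

Lemma maxprod_ge p q i : mdist (p i) (q i) <= mdist p q.
Proof. exact: (le_bigmax _ (fun i => mdist (p i) (q i))). Qed.

Lemma maxprod_le p q t : 0 <= t -> (forall i, mdist (p i) (q i) <= t) ->
  mdist p q <= t.
Proof. by move=> t0 le_t; apply: bigmax_le. Qed.

End Maxprod.

Lemma maxprod_dist_eq (I J : finType) (T : I -> metricType R)
    (U : J -> metricType R) (p q : maxprod T) (p' q' : maxprod U) :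
    (forall j, exists i, mdist (p' j) (q' j) <= mdist (p i) (q i)) ->
    (forall i, exists j, mdist (p i) (q i) <= mdist (p' j) (q' j)) ->
  mdist p' q' = mdist p q.
Proof.
move=> leT leU; apply/le_anti/andP; split.
  apply: maxprod_le => [|j]; first exact: mdist_ge0.
  by have [i /le_trans] := leT j; apply; apply: maxprod_ge.
apply: maxprod_le => [|i]; first exact: mdist_ge0.
by have [j /le_trans] := leU i; apply; apply: maxprod_ge.
Qed.

Lemma maxprod_iso (I : finType) (T U : I -> metricType R) :
  (forall i, T i ≅ U i) -> maxprod T ≅ maxprod U.
Proof.
move=> TU; pose h i : isom (T i) (U i) := unsquash (TU i).
apply: (@surj_iso _ _ (fun p : maxprod T => (fun i => h i (p i)) : maxprod U)).
  by move=> p q; apply: maxprod_dist_eq => i; exists i; rewrite isom_dist.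
move=> q; exists (fun i => isom_inv (h i) (q i)).
by apply: functional_extensionality_dep => i; rewrite isom_invK.
Qed.

(** The preimage of a point is found by choice, coordinate by coordinate, to
    avoid computing with the transport along the inverse of [e]. *)
Lemma maxprod_reindex (I J : finType) (T : I -> metricType R) (e : J -> I) :
  bijective e -> maxprod T ≅ maxprod (fun j => T (e j)).
Proof.
case=> e' eK e'K.
apply: (@surj_iso _ _ (fun p : maxprod T =>
  (fun j => p (e j)) : maxprod (fun j => T (e j)))).
  move=> p q; apply: maxprod_dist_eq => [j|i]; first by exists (e j).
  by exists (e' i); rewrite e'K.
move=> q.
have [i|p pE] := @dep_choice I T
    (fun i a => forall j (ij : e j = i), a = ecast i (T i) ij (q j)).
  rewrite -(e'K i); exists (q (e' i)) => j ij.
  have jE := can_inj eK ij; case: _ / jE in ij *.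
  by rewrite eq_axiomK.
exists p; apply: functional_extensionality_dep => j.
by rewrite (pE (e j) j erefl).
Qed.

Lemma maxprod_swap (I J : finType) (T : I -> J -> metricType R) :
  maxprod (fun i => maxprod (T i)) ≅ maxprod (fun j => maxprod (T^~ j)).
Proof.
apply: (@surj_iso _ _ (fun p : maxprod (fun i => maxprod (T i)) =>
  (fun j i => p i j) : maxprod (fun j => maxprod (T^~ j)))); last first.
  by move=> q; exists (fun i j => q j i).
move=> p q; apply/le_anti/andP; split; apply: maxprod_le;
  rewrite ?mdist_ge0// => i; apply: maxprod_le; rewrite ?mdist_ge0// => j.
  exact: le_trans (maxprod_ge (p j) (q j) i) (maxprod_ge p q j).
exact: le_trans (maxprod_ge (fun i => p i j) (fun i => q i j) i)
  (maxprod_ge (T := fun j => maxprod (T^~ j))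
    (fun j i => p i j) (fun j i => q i j) j).
Qed.

Lemma maxprod_curry (I : finType) (J : I -> finType)
    (T : forall i, J i -> metricType R) :
  maxprod (fun u : {i & J i} => T (tag u) (tagged u)) ≅
  maxprod (fun i => maxprod (T i)).
Proof.
pose cur (p : maxprod (fun u : {i & J i} => T (tag u) (tagged u))) :
  maxprod (fun i => maxprod (T i)) := fun i j => p (Tagged J j).
apply: (@surj_iso _ _ cur) => [p q|q]; last first.
  by exists (fun u => q (tag u) (tagged u)).
apply/le_anti/andP; split.
  apply: maxprod_le => [|i]; first exact: mdist_ge0.
  apply: maxprod_le => [|j]; first exact: mdist_ge0.
  exact: maxprod_ge p q (Tagged J j).
apply: maxprod_le => [|[i j]]; first exact: mdist_ge0.
exact: le_trans (maxprod_ge (cur p i) (cur q i) j)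
  (maxprod_ge (cur p) (cur q) i).
Qed.

Lemma maxpow_maxpow k n P : maxpow k (maxpow n P) ≅ maxpow (k * n) P.
Proof.
apply: iso_trans (iso_sym (@maxprod_curry 'I_k (fun=> 'I_n) (fun=> fun=> P))) _.
have cardE : #|'I_(k * n)| = #|{: {_ : 'I_k & 'I_n}}|.
  by rewrite card_tagged sumnE big_map big_enum /= sum_nat_const !card_ord.
have castB : bijective (cast_ord cardE).
  by exists (cast_ord (esym cardE)); [exact: cast_ordK | exact: cast_ordKV].
exact: (@maxprod_reindex _ _ (fun=> P) _ (bij_comp (@enum_val_bij _)
  (bij_comp castB (@enum_rank_bij _)))).
Qed.

End Isometries.

(** * Refinement of product decompositions into primes *)

Section Submetric.
Context {R : realType} (X : metricType R) (P : X -> Prop).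

Let sub_dist (u v : {x : X | `[< P x >]}) : R := mdist (val u) (val v).

Lemma sub_is_metric : is_metric sub_dist.
Proof.
rewrite /sub_dist; split=> [u|u v|u v|v u w]; first exact: mdistxx.
- by move/mdist_positivity/val_inj.
- exact: metric_sym.
- exact: metric_triangle.
Qed.

Definition submetric : metricType R := metric_of sub_is_metric.

Definition in_sub x (Px : P x) : submetric := exist _ x (asboolT Px).

Lemma sub_prop (u : submetric) : P (sval u).
Proof. by case: u => x /= /asboolP. Qed.

Lemma sub_eq (u v : submetric) : sval u = sval v -> u = v.
Proof. exact: val_inj. Qed.

End Submetric.

Section MetricDecompositions.
Context {R : realType}.
Implicit Types X A : metricType R.

(** Respecting all threshold relations amounts to decomposing the space into a
    max product, see [decomp_dist] and [coord_op_decomp]. *)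
Definition metric_decomp X (g : X -> X -> X) : Prop :=
  forall t, decomp_op (@threshold R X t) g.

Lemma decomp_dist X (g : X -> X -> X) o x y : metric_decomp g ->
  mdist x y = Num.max (mdist (g x o) (g y o)) (mdist (g o x) (g o y)).
Proof.
move=> Dg; have D := Dg (mdist x y).
apply/le_anti/andP; split; last first.
  by rewrite ge_max; apply/andP; split; apply: (dec_rel D);
    rewrite /threshold ?mdistxx ?mdist_ge0.
set t := Num.max _ _; have Dt := Dg t.
have -> : mdist x y = mdist (g (g x o) (g o x)) (g (g y o) (g o y)).
  by rewrite !(dec_l D) !(dec_r D) !(dec_id D).
by apply: (dec_rel Dt); rewrite /threshold le_max lexx ?orbT.
Qed.

(** The slices through a point [o] are factors of [A].  One of them is a single
    point, which makes the corresponding coordinate constant. *)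
Lemma prime_decomp A (g : A -> A -> A) : linf_prime A -> metric_decomp g ->
  (forall x y, g x y = x) \/ (forall x y, g x y = y).
Proof.
move=> [[o _] A_indec] Dg; have D := Dg 0.
pose Y := @submetric R A (fun x => g x o = x).
pose Z := @submetric R A (fun x => g o x = x).
pose f x : (Y * Z)%type :=
  (in_sub (P := fun x => g x o = x) (dec_l D x o o),
   in_sub (P := fun x => g o x = x) (dec_r D o o x)).
have fd x y : mdist (f x) (f y) = mdist x y.
  by rewrite [RHS](decomp_dist o _ _ Dg).
have fs yz : exists x, f x = yz.
  case: yz => y z; exists (g (sval y) (sval z)).
  congr (_, _); apply: sub_eq => /=.
    by rewrite (dec_l D); apply: (sub_prop y).
  by rewrite (dec_r D); apply: (sub_prop z).
have [h _] := surj_isom fd fs.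
case: (A_indec _ _ h) => -[c cE]; [right|left] => x y.
  have fE u : g u o = sval c by rewrite -(cE (f u).1).
  by rewrite -(dec_l D x o) fE -(fE y) (dec_l D) (dec_id D).
have fE u : g o u = sval c by rewrite -(cE (f u).2).
by rewrite -(dec_r D x o y) fE -(fE x) (dec_r D) (dec_id D).
Qed.

End MetricDecompositions.

Section Coordinates.
Context {R : realType} {X : metricType R} {I : finType} {A : I -> metricType R}.
Context (h : isom X (maxprod A)).

Lemma coord_inj x y : (forall i, h x i = h y i) -> x = y.
Proof.
move=> hxy; apply: (can_inj (isomK h)).
exact: functional_extensionality_dep.
Qed.

(** The decomposition of the product into its i-th factor and all the others. *)
Definition coord_op (i : I) (x y : X) : X :=
  isom_inv h (fun k => if k == i then h x k else h y k).

Lemma coord_opE i x y k :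
  h (coord_op i x y) k = if k == i then h x k else h y k.
Proof. by rewrite /coord_op isom_invK. Qed.

Lemma coord_op_decomp i : metric_decomp (coord_op i).
Proof.
move=> t; split=> [x|x y z|x y z|x x' y y'].
- by apply: coord_inj => k; rewrite coord_opE if_same.
- by apply: coord_inj => k; rewrite !coord_opE; case: eqP.
- by apply: coord_inj => k; rewrite !coord_opE; case: eqP.
rewrite /threshold => xx' yy'; rewrite -(isom_dist h).
apply: maxprod_le => [|k]; first exact: le_trans (mdist_ge0 _ _) xx'.
by rewrite !coord_opE; case: eqP => _; apply: le_trans (maxprod_ge _ _ k) _;
  rewrite isom_dist.
Qed.

Context (o : X).

(** The slice through [o] in the i-th direction, a copy of [A i] in [X]. *)
Definition embed (i : I) (a : A i) : X := isom_inv h (eqtype.dfwith (h o) a).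

Lemma embedE i (a : A i) : h (embed a) = eqtype.dfwith (h o) a.
Proof. by rewrite /embed isom_invK. Qed.

Lemma embedK i (a : A i) : h (embed a) i = a.
Proof. by rewrite embedE dfwith_in. Qed.

Lemma embed_coord i x : embed (h x i) = coord_op i x o.
Proof.
apply: coord_inj => k; rewrite embedE coord_opE.
case: eqP => [->|/eqP ki]; first by rewrite dfwith_in.
by rewrite dfwith_out // eq_sym.
Qed.

Lemma embed_base i : embed (h o i) = o.
Proof. by rewrite embed_coord (dec_id (coord_op_decomp i 0)). Qed.

Lemma coord_op_embed i (a : A i) : coord_op i (embed a) o = embed a.
Proof. by rewrite -embed_coord embedK. Qed.

Lemma embed_dist i (a b : A i) : mdist (embed a) (embed b) = mdist a b.
Proof.
rewrite -(isom_dist h) !embedE; apply/le_anti/andP; split.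
  apply: maxprod_le => [|k]; first exact: mdist_ge0.
  case: (eqVneq i k) => [ik|ik].
    by case: k / ik; rewrite !dfwith_in.
  by rewrite !dfwith_out // mdistxx mdist_ge0.
have := maxprod_ge (eqtype.dfwith (h o) a) (eqtype.dfwith (h o) b) i.
by rewrite !dfwith_in.
Qed.

Lemma coord_op_out i k x : i != k -> coord_op k (coord_op i x o) o = o.
Proof.
move=> ik; apply: coord_inj => l; rewrite !coord_opE.
by case: eqP => // ->; rewrite eq_sym (negbTE ik).
Qed.

End Coordinates.

Section Refinement.
Context {R : realType} {X : metricType R} (o : X) (r : R).
Context (r_ge0 : 0 <= r) (conn : connected_over (@threshold R X r))
  (sep : separating_over (@threshold R X r)).

Lemma metric_decomp_comm (f g : X -> X -> X) (Df : metric_decomp f)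
    (Dg : metric_decomp g) x y z w :
  f (g x y) (g z w) = g (f x z) (f y w).
Proof.
have Rxx : reflexive (@threshold R X r) by move=> u; rewrite /threshold mdistxx.
have thin u v :
    below (@threshold R X r) u v -> below (@threshold R X r) v u -> u = v.
  move=> uv vu; apply: contrapT => /sep[c].
  suff -> : threshold r c u = threshold r c v by rewrite addbb.
  by apply/idP/idP; [exact: uv|exact: vu].
have path_conn u v : exists2 s, path (@threshold R X r) u s & last u s = v.
  by have [->|/conn//] := pselect (u = v); exists [::].
exact: (decomp_comm Rxx thin path_conn (Df r) (Dg r)).
Qed.

Section TwoDecompositions.
Context {I J : finType} {A : I -> metricType R} {B : J -> metricType R}.
Context (h : isom X (maxprod A)) (h' : isom X (maxprod B)).

Local Notation e i x := (coord_op h i x o).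
Local Notation e' j x := (coord_op h' j x o).

(** This is where the graph is used: the projection to a slice through [o] is a
    homomorphism for the operations of the other decomposition. *)
Lemma proj_op i j x y :
  e i (coord_op h' j x y) = coord_op h' j (e i x) (e i y).
Proof.
rewrite -[in LHS](dec_id (coord_op_decomp h' j 0) o).
exact: metric_decomp_comm (coord_op_decomp h i) (coord_op_decomp h' j) _ _ _ _.
Qed.

Lemma proj_comm i j x : e i (e' j x) = e' j (e i x).
Proof. by rewrite proj_op (dec_id (coord_op_decomp h i 0)). Qed.

(** The operations of the second decomposition restrict to the slice of [A i]
    and are trivial there by primality.  If all of them were the second
    projection, every point of the slice would have the same coordinates as [o]
    in the second decomposition, and [A i] would be a point. *)
Lemma prime_in_factor i : linf_prime (A i) ->
  exists j, forall x, e' j (e i x) = e i x.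
Proof.
move=> Ai; pose emb (a : A i) := embed h o a.
pose g j (p q : A i) : A i := h (coord_op h' j (emb p) (emb q)) i.
have embg j p q : emb (g j p q) = coord_op h' j (emb p) (emb q).
  by rewrite /emb /g embed_coord proj_op !coord_op_embed.
have Dg j : metric_decomp (g j).
  move=> t; have D := coord_op_decomp h' j t.
  split=> [p|p q s|p q s|p p' q q' pp' qq'].
  - by rewrite /g (dec_id D) /emb embedK.
  - by rewrite {1}/g embg (dec_l D).
  - by rewrite {1}/g embg (dec_r D).
  rewrite /threshold -(embed_dist h o) -/(emb _) -/(emb _) !embg.
  by apply: (dec_rel D); rewrite /threshold embed_dist.
have [[j jE]|none] := pselect (exists j, forall p q, g j p q = p).
  exists j => x; rewrite -(embed_coord h o i x) -/(emb _).
  by rewrite -{1}(embed_base h o i) -/(emb (h o i)) -embg jE.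
have sndE j p q : g j p q = q.
  by case: (prime_decomp Ai (Dg j)) => // fstE; case: none; exists j.
case: Ai => -[a [b ab]] _; case: ab.
suff all_o c : c = h o i by rewrite (all_o a) (all_o b).
suff embc : embed h o c = o by rewrite -(embedK h o c) embc.
apply: (coord_inj (h := h')) => j.
have := embg j c (h o i); rewrite sndE /emb embed_base.
move=> /(congr1 (fun x => h' x j)).
by rewrite coord_opE eqxx.
Qed.

(** A point of the slice of [B j] is moved only in the directions i with
    s i = j: in any other direction its projection is also a point of the slice
    of [B (s i)], which meets that of [B j] only in [o]. *)
Lemma factor_iso (s : I -> J) : (forall i x, e' (s i) (e i x) = e i x) ->
  forall j, B j ≅ maxprod (fun u : {i | s i == j} => A (val u)).
Proof.
move=> sP j; pose emb (b : B j) := embed h' o b.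
have projE i x : e i (e' j x) = if s i == j then e i x else o.
  rewrite proj_comm; case: eqP => [<-|/eqP sij]; first exact: sP.
  by rewrite -sP; apply: coord_op_out.
have proj_emb i b : s i != j -> h (emb b) i = h o i.
  move=> sij; rewrite /emb -coord_op_embed.
  have := projE i (emb b); rewrite (negbTE sij) => /(congr1 (fun x => h x i)).
  by rewrite coord_opE eqxx.
apply: (@surj_iso _ _ _ (fun b : B j => (fun u => h (emb b) (val u)) :
  maxprod (fun u : {i | s i == j} => A (val u)))) => [a b|p].
  rewrite -(embed_dist h' o a b) -[in RHS](isom_dist h).
  apply/le_anti/andP; split.
    apply: maxprod_le => [|u]; first exact: mdist_ge0.
    exact: maxprod_ge (h (emb a)) (h (emb b)) (val u).
  apply: maxprod_le => [|i]; first exact: mdist_ge0.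
  have [sij|sij] := boolP (s i == j); last first.
    by rewrite -/(emb a) -/(emb b) !proj_emb // mdistxx mdist_ge0.
  exact: (maxprod_ge (T := fun u : {i | s i == j} => A (val u))
    (fun u => h (emb a) (val u)) (fun u => h (emb b) (val u)) (exist _ i sij)).
have [i|q qE] := @dep_choice I A (fun i a =>
    (forall sij : s i == j, a = p (exist _ i sij)) /\ (s i != j -> a = h o i)).
  have [sij|/negP sij] := pselect (s i == j); last first.
    by exists (h o i); split=> // sij'; case/negP: sij.
  exists (p (exist _ i sij)); split=> [sij'|]; last by rewrite sij.
  by rewrite (bool_irrelevance sij' sij).
pose x := isom_inv h q; have hx : h x = q by rewrite /x isom_invK.
exists (h' x j); apply: functional_extensionality_dep => -[i sij] /=.
rewrite /emb embed_coord.
have := projE i x; rewrite sij => /(congr1 (fun x => h x i)).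
by rewrite !coord_opE eqxx hx (proj1 (qE i) sij).
Qed.

End TwoDecompositions.

(** The slice of [A i] lies in that of [B (s i)], which lies in that of
    [A (t (s i))].  As [A i] has two points, t (s i) = i and the three slices
    coincide. *)
Lemma factor_matching (I J : finType) (A : I -> metricType R)
    (B : J -> metricType R) :
    (forall i, linf_prime (A i)) -> (forall j, linf_prime (B j)) ->
    X ≅ maxprod A -> X ≅ maxprod B ->
  exists s : I -> J, injective s /\ forall i, A i ≅ B (s i).
Proof.
move=> A_prime B_prime [h] [h'].
have [s sP] := choice (fun i => prime_in_factor h h' (A_prime i)).
have [t tP] := choice (fun j => prime_in_factor h' h (B_prime j)).
have proj_st i x : coord_op h (t (s i)) (coord_op h i x o) o = coord_op h i x o.
  by rewrite -(sP i x) tP.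
have sK : cancel s t.
  move=> i; apply/eqP; apply: contrapT => /negP tsi.
  case: (A_prime i) => -[a [b ab]] _; case: ab.
  suff all_o c : c = h o i by rewrite (all_o a) (all_o b).
  have := proj_st i (embed h o c); rewrite coord_op_out 1?eq_sym //.
  by rewrite coord_op_embed => ->; rewrite embedK.
exists s; split=> [|i]; first exact: can_inj sK.
pose f (a : A i) := h' (embed h o a) (s i).
have fK a : embed h' o (f a) = embed h o a.
  by rewrite /f embed_coord -(coord_op_embed h o a) sP.
apply: (@surj_iso _ _ _ f) => [a b|b].
  by rewrite -(embed_dist h' o) !fK embed_dist.
exists (h (embed h' o b) i).
rewrite /f embed_coord.
have := tP (s i) (embed h' o b).
by rewrite sK coord_op_embed => ->; exact: embedK.
Qed.

End Refinement.

(** * Multiplicities of the prime factors and roots *)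

Section Multiplicities.
Context {R : realType} {s : nat} (A : 'I_s -> metricType R).

(** Only the number of factors of each type matters. *)
Lemma typed_power (I : finType) (t : I -> 'I_s) :
  maxprod (fun k => A (t k)) ≅
  power_prod A (fun i => #|[set k | t k == i]%SET|).
Proof.
pose n i := #|[set k | t k == i]%SET|.
pose e (u : {i & 'I_(n i)}) : I := enum_val (tagged u).
have te u : t (e u) = tag u.
  by have := enum_valP (tagged u); rewrite inE => /eqP.
have e_inj : injective e.
  move=> [i a] [j b] eab; have ij : i = j.
    exact: etrans (esym (te (Tagged _ a))) (etrans (congr1 t eab) (te _)).
  by case: j / ij b eab => b /enum_val_inj /= ->.
have e_surj k : exists u, e u = k.
  have kk : k \in [set k' | t k' == t k]%SET by rewrite inE.
  exists (Tagged (fun i => 'I_(n i)) (enum_rank_in kk k)).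
  by rewrite /e /= enum_rankK_in.
have [e' e'K] := choice e_surj.
have eB : bijective e by exists e' => // u; apply: e_inj; rewrite e'K.
apply: iso_trans (maxprod_reindex (fun k => A (t k)) eB) _.
have -> : (fun u => A (t (e u))) = (fun u => A (tag u)).
  by apply/funext => u; rewrite te.
exact: (@maxprod_curry _ _ (fun i => 'I_(n i)) (fun i _ => A i)).
Qed.

Lemma power_flat (m : 'I_s -> nat) :
  power_prod A m ≅ maxprod (fun u : {i & 'I_(m i)} => A (tag u)).
Proof.
exact: iso_sym (@maxprod_curry _ _ (fun i => 'I_(m i)) (fun i _ => A i)).
Qed.

Lemma maxpow_power k (n : 'I_s -> nat) :
  maxpow k (power_prod A n) ≅ power_prod A (fun i => k * n i)%N.
Proof.
apply: iso_trans (maxprod_swap (fun=> fun i => maxpow (n i) (A i))) _.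
by apply: maxprod_iso => i; exact: maxpow_maxpow.
Qed.

Context {X : metricType R} (o : X) (r : R) (r_ge0 : 0 <= r)
  (conn : connected_over (@threshold R X r))
  (sep : separating_over (@threshold R X r)).
Context (A_prime : forall i, linf_prime (A i))
  (A_noniso : forall i j, i != j -> ~ (A i ≅ A j)).

Lemma card_tag (m : 'I_s -> nat) i :
  #|[set u : {i & 'I_(m i)} | tag u == i]%SET| = m i.
Proof.
have inj : injective (@Tagged _ i (fun i => 'I_(m i))) by exact: eq_from_Tagged.
rewrite -[RHS]card_ord -(card_imset _ inj); apply: eq_card => -[j b].
rewrite inE; apply/eqP/imsetP => [ji|[a _ ->]] //.
by case: i / ji {inj}; exists b.
Qed.

Lemma multiplicity_le (m m' : 'I_s -> nat) :
  X ≅ power_prod A m -> X ≅ power_prod A m' -> forall i, (m i <= m' i)%N.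
Proof.
move=> Xm Xm' i.
have [f [f_inj fA]] := factor_matching o r_ge0 conn sep
  (fun u => A_prime (tag u)) (fun u => A_prime (tag u))
  (iso_trans Xm (power_flat m)) (iso_trans Xm' (power_flat m')).
have tag_f u : tag (f u) = tag u.
  apply/eqP; apply: contrapT => /negP; rewrite eq_sym => /A_noniso.
  by apply; exact: fA.
rewrite -(card_tag m i) -(card_tag m' i) -(card_imset _ f_inj).
apply: subset_leq_card; apply/fintype.subsetP => _ /imsetP[u + ->].
by rewrite !inE tag_f.
Qed.

(** One copy of [P] inside [X] is a product of [n i] copies of each [A i].  As
    all copies are isometric, [X] has multiplicities [k * n i], and
    multiplicities are unique. *)
Theorem power_root k P m : (0 < k)%N ->
    X ≅ power_prod A m -> maxpow k P ≅ X ->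
  (forall i, k %| m i)%N /\ P ≅ kth_root k A m.
Proof.
move=> k0 Xm PX.
have [h] := iso_trans Xm (power_flat m).
have [h'] := iso_sym PX.
have [f fP] := choice (fun u : {i & 'I_(m i)} =>
  prime_in_factor o r_ge0 conn sep h h' (A_prime (tag u))).
have Pn := iso_trans (factor_iso r_ge0 conn sep fP (Ordinal k0))
  (@typed_power _ (fun u => tag (val u))).
set n := (fun i => _) in Pn.
have mE i : m i = (k * n i)%N.
  have Xn : X ≅ power_prod A (fun i => k * n i)%N.
    apply: iso_trans (iso_sym PX) (iso_trans _ (maxpow_power k n)).
    by apply: maxprod_iso.
  apply/eqP; rewrite eqn_leq (multiplicity_le Xm Xn).
  exact: (multiplicity_le Xn Xm i).
split=> [i|]; first by rewrite mE dvdn_mulr.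
rewrite /kth_root (_ : (fun i => _) = n) //.
by apply/funext => i; rewrite mE mulKn.
Qed.

End Multiplicities.

(** * Power structures and presentations *)

Section PowerStructuresArise.
Local Open Scope quotient_scope.
Context {R : realType} {X : metricType R} {k : nat} (k_ge2 : (2 <= k)%N).
Implicit Types S : power_data X k_ge2.

Local Notation j_fst := (fst_ord k_ge2).

Lemma equiv_rel_eq (T : Type) (e e' : equiv_rel T) : e =2 e' -> e = e'.
Proof.
case: e e' => [e eP] [e' e'P] /= ee'.
have {}ee' : e = e' by apply/funext => x; apply/funext => y; exact: ee'.
by case: _ / ee' in e'P *; congr EquivRelPack; exact: Prop_irrelevance.
Qed.

(** The relations have to be identified before the types of the maps tau agree;
    stating the condition on the maps through points of [X] avoids any
    transport. *)
Lemma power_data_eq S S' :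
    (forall j x y, pow_rel S j x y = pow_rel S' j x y) ->
    (forall (j : 'I_k) (j0 : (0 < j)%N) x y,
      pow_tau (p := S) j0 (\pi x) = \pi y <->
      pow_tau (p := S') j0 (\pi x) = \pi y) ->
  S = S'.
Proof.
case: S S' => [r t] [r' t'] /= rE tE.
have rr' : r = r' by apply/funext => j; apply: equiv_rel_eq => x y; exact: rE.
case: _ / rr' in t' rE tE *; congr PowerData.
apply: functional_extensionality_dep => j.
apply: functional_extensionality_dep => j0; apply/funext => C.
rewrite -[C]reprK -[LHS]reprK; apply/esym/tE; exact/esym/reprK.
Qed.

(** tau_j [x]_j = [y]_1, with tau_1 read as the identity.  This family of
    relations on points determines a power structure ([linked_eq]). *)
Definition linked S (j : 'I_k) (x y : X) : Prop :=
  (forall j0 : (0 < j)%N, pow_tau (p := S) j0 (\pi x) = \pi y) /\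
  (j = j_fst -> pow_rel S j x y).

Lemma linked_tau {S} {j : 'I_k} (j0 : (0 < j)%N) {x y} :
  linked S j x y <-> pow_tau (p := S) j0 (\pi x) = \pi y.
Proof.
split=> [[]//|tE]; split=> [j1|jE]; first by rewrite (bool_irrelevance j1 j0).
by have := j0; rewrite jE.
Qed.

Lemma linked_fst {S x y} : linked S j_fst x y <-> pow_rel S j_fst x y.
Proof. by split=> [[_]|rxy]; [exact | split]. Qed.

Lemma fst_or_pos (j : 'I_k) : j = j_fst \/ (0 < j)%N.
Proof. by case: j => -[|j] jk; [left; exact: val_inj | right]. Qed.

(** The map tau_j is injective, and z represents the common value of tau_j. *)
Lemma linked_rel S (SP : is_power_structure S) j x y :
  pow_rel S j x y <-> exists z, linked S j x z /\ linked S j y z.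
Proof.
case: (fst_or_pos j) => [->|j0].
  split=> [rxy|[z [/linked_fst rxz /linked_fst ryz]]].
    exists y; split; apply/linked_fst => //; exact: equiv_refl.
  by rewrite (equiv_trans rxz) // equiv_sym.
split=> [/(eqquotP {eq_quot pow_rel S j}) rxy|
    [z [/(linked_tau j0) xz /(linked_tau j0) yz]]].
  exists (repr (pow_tau (p := S) j0 (\pi x))).
  by split; apply/(linked_tau j0); rewrite reprK ?rxy.
apply/(eqquotP {eq_quot pow_rel S j}); apply: (bij_inj (pow_tau_bij SP j0)).
by rewrite xz.
Qed.

Lemma linked_eq S S' : is_power_structure S -> is_power_structure S' ->
  (forall j x y, linked S j x y <-> linked S' j x y) -> S = S'.
Proof.
move=> SP S'P SS'; apply: power_data_eq => [j x y|j j0 x y].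
  apply/idP/idP => [/(linked_rel SP)|/(linked_rel S'P)] [z [xz yz]].
    by apply/(linked_rel S'P); exists z; split; apply/SS'.
  by apply/(linked_rel SP); exists z; split; apply/SS'.
by rewrite -!linked_tau; exact: SS'.
Qed.

Section Arising.
Context (P : metricType R) (phi : isom (maxpow k P) X).

Lemma const_dist (p q : P) :
  mdist ((fun=> p) : maxpow k P) (fun=> q) = mdist p q.
Proof.
apply/le_anti/andP; split.
  by apply: maxprod_le => [|i //]; exact: mdist_ge0.
exact: (maxprod_ge ((fun=> p) : maxpow k P) (fun=> q) j_fst).
Qed.

Lemma pres_coord_const j p : pres_coord phi j (phi (fun=> p)) = p.
Proof. by rewrite /pres_coord isomK. Qed.

(** The infimum is attained at points of the diagonal of [P^k]. *)
Lemma quot_dist_pres j (C D : {eq_quot pres_rel phi j}) :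
  quot_dist C D = mdist (pres_bar C) (pres_bar D).
Proof.
rewrite /quot_dist; set V := [set _ | _ in _].
have V_ge v : V v -> mdist (pres_bar C) (pres_bar D) <= v.
  case=> -[x y] /= [<- <-] <-; rewrite !pres_bar_pi -(isom_inv_dist phi).
  exact: maxprod_ge (isom_inv phi x) (isom_inv phi y) j.
have Vd : V (mdist (pres_bar C) (pres_bar D)).
  exists (phi (fun=> pres_bar C), phi (fun=> pres_bar D)) => /=.
    by split; apply: (can_inj (@pres_barK _ _ _ _ phi j));
      rewrite pres_bar_pi pres_coord_const.
  by rewrite isom_dist const_dist.
apply/le_anti/andP; split.
  by apply: ge_inf => //; exists (mdist (pres_bar C) (pres_bar D)).
by apply: lb_le_inf; first by exists (mdist (pres_bar C) (pres_bar D)).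
Qed.

Lemma arising_valid : is_power_structure (arising_data k_ge2 phi).
Proof.
split=> [j|C|x y|j j0|j j0 C D].
- split=> [C|C D|C D|D C E]; rewrite !quot_dist_pres.
  + exact: mdistxx.
  + by move/mdist_positivity/(can_inj (@pres_barK _ _ _ _ phi j)).
  + exact: metric_sym.
  + exact: metric_triangle.
- exists (phi (fun j => pres_bar (C j))); split=> [j|x xC].
    apply: (can_inj (@pres_barK _ _ _ _ phi j)).
    by rewrite pres_bar_pi /pres_coord isomK.
  rewrite -[RHS](isom_invK phi); congr (phi _); apply/funext => j.
  by rewrite -(xC j) pres_bar_pi.
- rewrite -(isom_inv_dist phi); apply: eq_bigr => j _.
  by rewrite quot_dist_pres !pres_bar_pi.
- by exists (pres_bar_inv phi j \o @pres_bar _ _ _ _ phi j_fst) => C /=;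
    rewrite pres_bar_invK pres_barK.
- by rewrite /= !quot_dist_pres !pres_bar_invK.
Qed.

Lemma linked_arising j x y :
  linked (arising_data k_ge2 phi) j x y <->
  pres_coord phi j x = pres_coord phi j_fst y.
Proof.
case: (fst_or_pos j) => [->|j0].
  by rewrite linked_fst; split=> [/eqP//|xy]; apply/eqP.
rewrite (linked_tau j0) /= pres_bar_pi.
split=> [/(congr1 (@pres_bar _ _ _ _ _ _))|->].
  by rewrite pres_bar_invK pres_bar_pi.
by rewrite -(pres_bar_pi phi) pres_barK.
Qed.

End Arising.

Lemma arising_eq P Q (phi : isom (maxpow k P) X) (psi : isom (maxpow k Q) X)
    (f : P -> Q) : injective f ->
    (forall j x, pres_coord psi j x = f (pres_coord phi j x)) ->
  arising_data k_ge2 phi = arising_data k_ge2 psi.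
Proof.
move=> f_inj fE; apply: linked_eq; [exact: arising_valid..|] => j x y.
by rewrite !linked_arising !fE; split=> [->|/f_inj].
Qed.

(** The j-th coordinate of x for [phi] is the first coordinate of the diagonal
    point y with that value; the common structure then says that the j-th
    coordinate of x for [psi] is the first coordinate of the same y.  So one
    map, read off on the diagonal, works for all coordinates. *)
Lemma arising_root_isom P Q (phi : isom (maxpow k P) X)
    (psi : isom (maxpow k Q) X) :
    arising_data k_ge2 phi = arising_data k_ge2 psi ->
  exists f : isom P Q, forall j x, pres_coord psi j x = f (pres_coord phi j x).
Proof.
move=> E; pose f p := pres_coord psi j_fst (phi (fun=> p)).
have fE j x : pres_coord psi j x = f (pres_coord phi j x).
  apply/linked_arising; rewrite -E; apply/linked_arising.
  by rewrite pres_coord_const.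
have constE p : isom_inv psi (phi (fun=> p)) = fun=> f p.
  apply/funext => j.
  by rewrite -[LHS]/(pres_coord psi j _) fE pres_coord_const.
have [h hE] : exists h : isom P Q, (h : P -> Q) = f.
  apply: surj_isom => [p q|q].
    by rewrite -const_dist -!constE isom_inv_dist isom_dist const_dist.
  exists (pres_coord phi j_fst (psi (fun=> q))).
  by rewrite -fE pres_coord_const.
by exists h; rewrite hE.
Qed.

(** The root is X/E_1 and the j-th coordinate of x is tau_j [x]_j.  The
    distance axiom makes this isometric, and the transversality axiom makes
    it onto. *)
Lemma power_structure_arises (S : power_structure X k_ge2) :
  exists (P : metricType R) (phi : isom (maxpow k P) X),
    pow_data S = arising_data k_ge2 phi.
Proof.
case: S => S SP /=; pose P : metricType R := metric_of (pow_metric SP j_fst).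
have [j|T TP] := @dep_choice _ _ (fun j (T : {eq_quot pow_rel S j} -> P) =>
   [/\ bijective T, (forall C D, mdist (T C) (T D) = quot_dist C D) &
       forall x y, linked S j x y <-> T (\pi x) = \pi y]).
  case: (fst_or_pos j) => [->|j0].
    exists id; split=> [|//|x y]; first by exists id.
    rewrite linked_fst; split=> [|] /(eqquotP {eq_quot pow_rel S j_fst}) //.
  exists (pow_tau (p := S) j0); split=> [|C D|x y].
  - exact: pow_tau_bij.
  - exact: pow_tau_dist.
  - exact: linked_tau.
pose coord x : maxpow k P := fun j => T j (\pi x).
have [h hE] : exists h : isom X (maxpow k P), (h : X -> maxpow k P) = coord.
  apply: surj_isom => [x y|p].
    rewrite (pow_dist SP) maxprodE; apply: eq_bigr => j _.
    by have [_ ->] := TP j.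
  have [j|C CE] := @dep_choice _ _ (fun j C => T j C = p j).
    by have [[T' _ T'K] _ _] := TP j; exists (T' (p j)).
  have [x [xC _]] := pow_transversal SP C.
  by exists x; apply/funext => j; rewrite /coord xC.
exists P, (isom_sym h); apply: linked_eq => //; first exact: arising_valid.
move=> j x y; rewrite linked_arising /pres_coord /= hE /coord.
have [_ _ ->] := TP j; have [_ _ T0] := TP j_fst.
suff -> : T j_fst (\pi y) = \pi y by [].
by apply/T0/linked_fst; exact: equiv_refl.
Qed.

End PowerStructuresArise.

(** * Cosets of the diagonal isometries *)

Lemma left_coset_eq (G : groupType) (H : set G) (g g' : G) :
  group_closed (mem H) ->
  left_coset H g = left_coset H g' <-> exists2 h, H h & g' = (g * h)%g.
Proof.
move=> Hgr; have [H1 _] := Hgr; have HM := group_closedM Hgr.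
have HV := group_closedV Hgr.
split=> [gg'|[h Hh ->]].
  have : left_coset H g' g' by exists 1%g; [exact: set_mem | rewrite mulg1].
  by rewrite -gg' => -[h Hh <-]; exists h.
apply/seteqP; split=> [_ [u Hu <-]|_ [u Hu <-]].
  exists (h^-1 * u)%g; last by rewrite -mulgA mulVKg.
  by apply: set_mem; apply: HM; [apply: HV|]; apply: mem_set.
exists (h * u)%g; last by rewrite mulgA.
by apply: set_mem; apply: HM; apply: mem_set.
Qed.

Lemma card_range_eq (T U V : Type) (F : T -> U) (c : T -> V) :
    (forall u, exists t, F t = u) -> (forall t t', F t = F t' <-> c t = c t') ->
  range c #= [set: U].
Proof.
move=> /choice[t Ft] Fc.
have -> : range c = range (c \o t).
  apply/seteqP; split=> [_ [x _ <-]|_ [u _ <-]]; last by exists (t u).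
  by exists (F x) => //; apply/Fc; rewrite Ft.
by apply: inj_card_eq => u u' _ _ /Fc; rewrite !Ft.
Qed.

Section Cosets.
Context {R : realType} {X Q : metricType R} {k : nat} (k_ge2 : (2 <= k)%N).
Context (phi0 : isom (maxpow k Q) X).

Lemma power_structure_eq (S S' : power_structure X k_ge2) :
  pow_data S = pow_data S' -> S = S'.
Proof.
case: S S' => [S SP] [S' S'P] /= SS'; case: _ / SS' in S'P *.
by congr PowerStructure; exact: Prop_irrelevance.
Qed.

Lemma diagonal_isos_group : group_closed (mem (diagonal_isos phi0)).
Proof.
split=> [|_ _ /set_mem[f _ <-] /set_mem[f' _ <-]]; apply: mem_set.
  by exists (isom_id Q) => //; apply: isom_eq => x /=; rewrite isom_invK.
exists (isom_comp f (isom_sym f')) => //; apply: isom_eq => x /=.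
by rewrite isomK.
Qed.

(** An isometry f of the root carries the coordinates of g' \o phi0 to those of
    g \o phi0 if and only if g' = g * h for the diagonal isometry h that f
    defines. *)
Lemma arising_coset (g g' : Iso X) :
  arising_data k_ge2 (isom_comp g phi0) = arising_data k_ge2 (isom_comp g' phi0)
  <-> left_coset (diagonal_isos phi0) g = left_coset (diagonal_isos phi0) g'.
Proof.
rewrite (left_coset_eq _ _ diagonal_isos_group).
split=> [/esym/arising_root_isom[f fE]|[_ [f _ <-] ->]].
  exists (isom_comp (isom_comp phi0 (isom_pow k f)) (isom_sym phi0)).
    by exists f.
  apply: isom_eq => z /=.
  have -> : pow_fun f (isom_inv phi0 z) = isom_inv phi0 (isom_inv g (g' z)).
    apply/funext => j; have := fE j (g' z).
    by rewrite /pres_coord /= isomK /pow_fun => <-.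
  by rewrite !isom_invK.
apply: (arising_eq k_ge2 (can_inj (isom_invK f))) => j x.
by rewrite /pres_coord /= isomK.
Qed.

Lemma card_cosets :
    (forall S : power_structure X k_ge2, exists (P : metricType R)
      (phi : isom (maxpow k P) X),
      (P ≅ Q) /\ pow_data S = arising_data k_ge2 phi) ->
  left_cosets (diagonal_isos phi0) #= [set: power_structure X k_ge2].
Proof.
move=> arises.
pose F (g : Iso X) := PowerStructure (arising_valid k_ge2 (isom_comp g phi0)).
apply: (@card_range_eq (Iso X) _ _ F (left_coset (diagonal_isos phi0)))
  => [S|g g']; last first.
  rewrite -arising_coset; split=> [/(congr1 (@pow_data _ _ _ _))//|E].
  exact: power_structure_eq.
have [P [phi [[c] SE]]] := arises S.
have [h hE] : exists h : isom (maxpow k Q) X,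
    (h : maxpow k Q -> X) = fun p => phi (pow_fun (isom_inv c) p).
  apply: surj_isom => [p q|x].
    by rewrite isom_dist; apply: eq_bigr => j _; exact: isom_inv_dist.
  exists (pow_fun c (isom_inv phi x)).
  by rewrite (pow_funK (isomK c)) isom_invK.
exists (isom_comp h (isom_sym phi0)).
apply: power_structure_eq => /=.
have -> : isom_comp (isom_comp h (isom_sym phi0)) phi0 = h.
  by apply: isom_eq => p /=; rewrite isomK.
rewrite SE; apply/esym/(arising_eq k_ge2 (can_inj (isomK c))) => j x.
rewrite /pres_coord -{2}(isom_invK h x) hE isomK /pow_fun.
by rewrite isom_invK.
Qed.

End Cosets.

Theorem theorem1p3 (R : realType) (X : metricType R)
    (X_nonempty : [set: X] !=set0)
    (D_finite : finite_set (distance_set X))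
    (X_threshold : exists r, [/\ distance_set X r,
       connected_over (@threshold R X r) & separating_over (@threshold R X r)])
    (s : nat) (A : 'I_s -> metricType R) (m : 'I_s -> nat)
    (X_decomposition : prime_decomposition X A m)
    (k : nat) (k_ge2 : (2 <= k)%N) :
  ((exists i, ~~ (k %| m i)%N) -> ~ $| power_structure X k_ge2 |) /\
  ((forall i, (k %| m i)%N) ->
   [/\ forall (s' : nat) (A' : 'I_s' -> metricType R) (m' : 'I_s' -> nat),
         prime_decomposition X A' m' ->
         (forall i, (k %| m' i)%N) /\ (kth_root k A' m' ≅ kth_root k A m),
       forall S : power_structure X k_ge2,
         exists (P : metricType R) (phi : isom (maxpow k P) X),
           (P ≅ kth_root k A m) /\ pow_data S = arising_data k_ge2 phi,
       maxpow k (kth_root k A m) ≅ X &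
       forall phi0 : isom (maxpow k (kth_root k A m)) X,
         group_closed (mem (diagonal_isos phi0)) /\
         left_cosets (diagonal_isos phi0) #= [set: power_structure X k_ge2]]).
Proof.
have [o _] := X_nonempty.
have [r [[z _ rE] conn sep]] := X_threshold.
have r_ge0 : 0 <= r by rewrite -rE mdist_ge0.
have k0 : (0 < k)%N := ltnW k_ge2.
have root_unique s' (A' : 'I_s' -> metricType R) m' P :
    prime_decomposition X A' m' -> maxpow k P ≅ X ->
    (forall i, (k %| m' i)%N) /\ P ≅ kth_root k A' m'.
  case=> _ A'_prime A'_noniso _ XA' PX.
  exact: (power_root o r_ge0 conn sep A'_prime A'_noniso k0 XA' PX).
have arises (S : power_structure X k_ge2) : exists (P : metricType R)
    (phi : isom (maxpow k P) X),
    [/\ forall i, (k %| m i)%N, P ≅ kth_root k A m &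
        pow_data S = arising_data k_ge2 phi].
  have [P [phi SE]] := power_structure_arises S.
  have [km Pm] := root_unique _ _ _ P X_decomposition (squash phi).
  by exists P, phi.
split=> [[i kmi] [S]|km].
  by have [P [phi [/(_ i) km _ _]]] := arises S; rewrite km in kmi.
have root_pow : maxpow k (kth_root k A m) ≅ X.
  case: X_decomposition => _ _ _ _ XA.
  apply: iso_trans (maxpow_power _ _ _) _.
  rewrite (_ : (fun i => _) = m); first exact: iso_sym.
  by apply/funext => i; rewrite mulnC divnK.
have arises' (S : power_structure X k_ge2) : exists (P : metricType R)
    (phi : isom (maxpow k P) X),
    (P ≅ kth_root k A m) /\ pow_data S = arising_data k_ge2 phi.
  by have [P [phi [_ PE SE]]] := arises S; exists P, phi.
split=> [s' A' m' X_decomposition'| | |phi0] //.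
  have [km' root_iso] := root_unique _ _ _ _ X_decomposition' root_pow.
  by split=> //; exact: iso_sym.
by split; [exact: diagonal_isos_group | exact: card_cosets].
Qed.
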